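(* Let $X$ be the Cantor set with Boolean algebra of clopen sets $\mathcal{B}$, and let $G\le\mathrm{Homeo}(X)$ be an ample group with decomposition $G=\bigcup_{n\in\mathbb{N}}G_n$, $\mathcal{B}=\bigcup_{n\in\mathbb{N}}\mathcal{B}_n$ and dimension range $\varinjlim (\mathcal{B}_n | G_n, (\mathcal{B}_n | G_n)_+, \Gamma_n)$. Then $G$ is uniformly discrete if and only if the matrices describing all but finitely many of the morphisms in the direct limit have only $1$s and $0$s as entries.
   Context: For a finite subalgebra $\mathcal{A}\le\mathcal{B}$, $\mathrm{at}(\mathcal{A})$ is its set of atoms (minimal nonzero elements). For $G\le \mathrm{Homeo}(X)$ and a $G$-invariant subalgebra $\mathcal{A}\le\mathcal{B}$, $\mathbf{F}_{\mathcal{A}}(G)$ is the group of all $g\in\mathrm{Homeo}(X)$ for which there are a finite partition $X=U_1\sqcup\dots\sqcup U_n$ with all $U_i\in\mathcal{A}$ and $g_1,\dots,g_n\in G$ with $g|_{U_i}=g_i|_{U_i}$ for every $i$. $G$ is piecewise full on $\mathcal{A}$ if $\mathcal{A}$ is $G$-invariant and $\mathbf{F}_{\mathcal{A}}(G)=G$; $G$ is piecewise full if it is piecewise full on $\mathcal{B}$. $G$ is ample if it is piecewise full, locally finite, countable, and the fixed-point set $\mathrm{Fix}(g)$ is clopen for every $g\in G$. $G$ is uniformly discrete if there is a clopen partition $\mathcal{P}$ of $X$ with $|Gx\cap U|\le1$ for all $x\in X$, $U\in\mathcal{P}$. Decompositions: $G=\bigcup_n G_n$ and $\mathcal{B}=\bigcup_n\mathcal{B}_n$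 are increasing unions of finite subgroups and finite subalgebras, with $G_0$ trivial, $\mathcal{B}_0=\{\emptyset,X\}$, and for each $n$, $G_n$ is piecewise full on $\mathcal{B}_n$ and the setwise stabiliser in $G_n$ of each atom of $\mathcal{B}_n$ equals its pointwise stabiliser. Dimension range of $(\mathcal{B}_n,G_n)$: $\mathcal{B}_n|G_n$ is the abelian group generated by the set $\mathcal{B}_n/G_n$ of $G_n$-orbits on $\mathcal{B}_n$, with a relation $w-v-u$ (that is, $w=u+v$) whenever there are disjoint $\tilde u\in u$, $\tilde v\in v$ with $\tilde u\sqcup\tilde v\in w$; it is an ordered abelian group via the inclusion order on $\mathcal{B}_n$. Writing $V_n=\mathrm{at}(\mathcal{B}_n)/G_n$ for the set of $G_n$-orbits of atoms and $d(v)$ for the number of atoms in the orbit $v\in V_n$, the triple $(\mathcal{B}_n|G_n,(\mathcal{B}_n|G_n)_+,\Gamma_n)$ is isomorphic to $(\mathbb{Z}^{|V_n|},\mathbb{Z}_+^{|V_n|},\{(i_v)_{v\in V_n}: 0\le i_v\le d(v)\})$, where $\mathbb{Z}_+^{|V_n|}$ is the submonoid of non-negative elements and $\Gamma_n$ is called the scale. Morphisms and matrices: for each $n$, the inclusion $(\mathcal{B}_n,G_n)\le(\mathcal{B}_{n+1},G_{n+1})$ induces a morphism of dimension ranges, completely described by the $|V_n|\times|V_{n+1}|$ matrix whose $(i,j)$ entry is the number of atoms of $\mathcal{B}_{n+1}$ in the orbit $v_j\in V_{n+1}$ that are contained in a given atom of $\mathcal{B}_n$ in the orbit $v_i\in V_n$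 (this is independent of the atom chosen in $v_i$). In other words, it is the adjacency matrix between levels $V_n$ and $V_{n+1}$ of the Bratteli diagram associated to the decomposition. The dimension range of $G$ is the direct limit of the dimension ranges of the $(\mathcal{B}_n,G_n)$ with these morphisms.
   Formalization: The 0/1 condition is imposed on all morphisms from level n to every level m ≥ n, composites included, for all but finitely many n; for consecutive levels only, the ''if'' fails (prefix permutations of {a,b}^N preserving the last letter). *)

(* Defs.v *)
From HB Require Import structures.
From mathcomp Require Import all_boot all_order all_algebra.
From mathcomp Require Import generic_quotient ring_quotient.
From mathcomp Require Import finmap freeg.
From mathcomp Require Import all_classical all_reals all_analysis.

Set Implicit Arguments.
Unset Strict Implicit.
Unset Printing Implicit Defensive.

Import Order.TTheory GRing.Theory Num.Theory.
Import Quotient.Exports.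

Local Open Scope classical_set_scope.
Local Open Scope ring_scope.
Local Open Scope quotient_scope.

Section HomeoGroups.
Context {X : topologicalType}.
Implicit Types (f g h : X -> X) (G H : set (X -> X)) (A : set (set X)).

Definition homeo : set (X -> X) :=
  [set g | continuous g /\
           exists h, [/\ continuous h, cancel g h & cancel h g]].

Definition homeo_subgroup G :=
  [/\ G `<=` homeo, G idfun, (forall g h, G g -> G h -> G (g \o h)) &
      (forall g, G g -> exists2 h, G h & cancel g h /\ cancel h g)].

Definition generated_subgroup (S : set (X -> X)) : set (X -> X) :=
  \bigcap_(H in [set H | homeo_subgroup H /\ S `<=` H]) H.

Definition locally_finite_group G :=
  forall S, finite_set S -> S `<=` G -> finite_set (generated_subgroup S).

Definition Fix g : set X := [set x | g x = x].

Definition point_orbit G (x : X) : set X := [set g x | g in G].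

Definition setwise_stab G (U : set X) := [set g | G g /\ g @` U = U].

Definition pointwise_stab G (U : set X) :=
  [set g | G g /\ forall x, U x -> g x = x].

Definition clopen_subalgebra A :=
  [/\ A `<=` clopen, A set0, (forall U, A U -> A (~` U)) &
      (forall U V, A U -> A V -> A (U `|` V))].

Definition atoms A : set (set X) :=
  [set a | [/\ A a, a !=set0 &
               forall b, A b -> b `<=` a -> b = set0 \/ b = a]].

Definition invariant_family G A := forall g U, G g -> A U -> A (g @` U).

Definition piecewise_group A G : set (X -> X) :=
  [set g | homeo g /\
     exists n (U : 'I_n -> set X) (h : 'I_n -> X -> X),
       [/\ partition [set: 'I_n] U [set: X],
           (forall i, A (U i)),
           (forall i, G (h i)) &
           (forall i x, U i x -> g x = h i x)]].

Definition piecewise_full_on A G :=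
  invariant_family G A /\ piecewise_group A G = G.

Definition ample G :=
  [/\ homeo_subgroup G, piecewise_full_on clopen G, locally_finite_group G,
      countable G & forall g, G g -> clopen (Fix g)].

Definition uniformly_discrete G :=
  exists P : set (set X),
    [/\ P `<=` clopen, partition P id [set: X] &
        forall x U, P U -> is_subset1 (point_orbit G x `&` U)].

Record ample_decomposition G (Gn : nat -> set (X -> X))
    (Bn : nat -> set (set X)) : Prop := AmpleDecomposition {
  dec_subgroup : forall n, homeo_subgroup (Gn n);
  dec_finite_group : forall n, finite_set (Gn n);
  dec_group_incr : forall n, Gn n `<=` Gn n.+1;
  dec_group_union : \bigcup_n Gn n = G;
  dec_subalgebra : forall n, clopen_subalgebra (Bn n);
  dec_finite_algebra : forall n, finite_set (Bn n);
  dec_algebra_incr : forall n, Bn n `<=` Bn n.+1;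
  dec_algebra_union : \bigcup_n Bn n = clopen;
  dec_group0 : Gn 0 = [set idfun];
  dec_algebra0 : Bn 0 = [set set0; setT];
  dec_full : forall n, piecewise_full_on (Bn n) (Gn n);
  dec_stab : forall n a, atoms (Bn n) a ->
    setwise_stab (Gn n) a = pointwise_stab (Gn n) a
}.

Definition set_orbit G (U : set X) : set (set X) := [set g @` U | g in G].

Definition orbits A G : set (set (set X)) := [set set_orbit G U | U in A].

Definition atom_orbits A G := orbits (atoms A) G.

End HomeoGroups.

Record scaled_group := ScaledGroup {
  sg_sort :> zmodType;
  sg_pos : set sg_sort;
  sg_scale : set sg_sort
}.

Definition scaled_group_morphism (D E : scaled_group) (f : D -> E) :=
  [/\ {morph f : x y / x + y},
      (forall x, sg_pos x -> sg_pos (f x)) &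
      (forall x, sg_scale x -> sg_scale (f x))].

(* A | G: the abelian group with generators the G-orbits on A and relators
   w - v - u whenever w contains a disjoint union of members of u and v. The
   positive cone is the submonoid spanned by the generators. *)
Section DimensionRange.
Context {X : topologicalType} (A : set (set X)) (G : set (X -> X)).

Local Notation free := {freeg (orbits A G : choiceType) / int}.

Definition dim_relators : set free :=
  [set r | exists (u v w : orbits A G) (U V : set X),
     [/\ (val u : set (set X)) U, (val v : set (set X)) V,
         U `&` V = set0, (val w : set (set X)) (U `|` V) &
         r = << w >> - << v >> - << u >>]].

Definition dim_relations : {pred free} := fun x =>
  `[< forall S : {pred free}, zmod_closed S ->
        (forall r, dim_relators r -> r \in S) -> x \in S >].

Lemma dim_relations_closed : zmod_closed dim_relations.
Proof.
split=> [|x y /asboolP xR /asboolP yR]; first by apply/asboolP => S [].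
apply/asboolP => S SZ SR; case: (SZ) => _; apply; first exact: xR.
exact: yR.
Qed.
HB.instance Definition _ :=
  GRing.isZmodClosed.Build free dim_relations dim_relations_closed.

Definition dim_group : zmodType := Quotient.quot (dim_relations : zmodClosed free).

(* The class of an orbit u (0 if u is not an orbit of G on A). *)
Definition dim_class (u : set (set X)) : dim_group :=
  if insub u is Some k then \pi_dim_group << (k : orbits A G) >> else 0.

Definition dim_range : scaled_group := {|
  sg_sort := dim_group;
  sg_pos := [set x | exists2 s : seq (set (set X)),
               (forall u, u \in s -> orbits A G u) &
               x = \sum_(u <- s) dim_class u];
  sg_scale := [set dim_class u | u in orbits A G]
|}.

End DimensionRange.

Section DimensionLift.
Context {X : topologicalType} (A : set (set X)) (G : set (X -> X)).
Context {W : zmodType} (f : set (set X) -> W).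

(* The additive map on the dimension range that sends the class of an orbit u
   to f u, provided that f is compatible with the relations. *)
Definition dim_lift (x : dim_range A G) : W :=
  fglift (fun k : (orbits A G : choiceType) => f (val k) : zmodule W)
    (repr (x : dim_group A G)).

Definition orbit_additive := forall (u v w : set (set X)) (U V : set X),
  orbits A G u -> orbits A G v -> orbits A G w ->
  u U -> v V -> U `&` V = set0 -> w (U `|` V) -> f w = f u + f v.

Hypothesis f_add : orbit_additive.

Local Notation free := {freeg (orbits A G : choiceType) / int}.
Let F : free -> W :=
  fglift (fun k : (orbits A G : choiceType) => f (val k) : zmodule W).

Let FB : {morph F : x y / x - y}.
Proof.
exact: (@lift_is_additive int (orbits A G : choiceType) (zmodule W)
          (fun k => f (val k))).
Qed.

Let F0 : F 0 = 0. Proof. by have := FB 0 0; rewrite !subrr. Qed.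
Let FN : {morph F : x / - x}.
Proof. by move=> x; rewrite -[- x]add0r FB F0 sub0r. Qed.
Let FD : {morph F : x y / x + y}.
Proof. by move=> x y; rewrite -[y in x + y]opprK FB FN opprK. Qed.

Let FU (k : orbits A G) : F << k >> = f (val k).
Proof. by rewrite /F liftU scale1r. Qed.

Let F_rel x : x \in dim_relations (A := A) (G := G) -> F x = 0.
Proof.
move=> /asboolP /(_ (fun x => F x == 0)) xF; apply/eqP; apply: xF.
  by split=> [|y z]; rewrite !unfold_in ?F0 // FB => /eqP -> /eqP ->; rewrite subr0.
move=> r [u [v [w [U [V [uU vV UV wUV ->]]]]]]; rewrite unfold_in !FB !FU.
rewrite (f_add _ _ _ uU vV UV wUV) ?addrK ?subrr //; apply/set_mem/valP.
Qed.

Let dim_liftE (x : free) : dim_lift (\pi_(dim_group A G) x) = F x.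
Proof.
apply/eqP; rewrite -subr_eq0 -[dim_lift _]/(F _) -FB; apply/eqP/F_rel.
by rewrite Quotient.idealrBE reprK.
Qed.

Lemma dim_liftD : {morph dim_lift : x y / x + y}.
Proof.
elim/quotW=> x; elim/quotW=> y.
by rewrite -[_ + _]/((\pi_(dim_group A G) x : dim_group A G) + \pi_(dim_group A G) y) -raddfD !dim_liftE FD.
Qed.

Lemma dim_lift_class u : orbits A G u -> dim_lift (dim_class A G u) = f u.
Proof.
move=> /mem_set uAG; rewrite /dim_class insubT dim_liftE FU.
by [].
Qed.

End DimensionLift.

Section OrbitTheory.
Context {X : topologicalType}.
Implicit Types (G : set (X -> X)) (A : set (set X)) (u w : set (set X)).

Lemma set_orbit_refl G U : homeo_subgroup G -> set_orbit G U U.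
Proof. by case=> _ G1 _ _; exists idfun => //; apply: image_id. Qed.

Lemma set_orbit_eq G U V :
  homeo_subgroup G -> set_orbit G U V -> set_orbit G V = set_orbit G U.
Proof.
move=> [_ G1 GM GV] [g Gg <-]; apply/seteqP; split=> W [h Gh <-].
  by exists (h \o g); [exact: GM | rewrite image_comp].
have [k Gk [gk kg]] := GV _ Gg; exists (h \o k); first exact: GM.
rewrite !image_comp; congr image; apply/funext => x /=; by rewrite gk.
Qed.

Lemma orbitsE A G u U :
  homeo_subgroup G -> orbits A G u -> u U -> u = set_orbit G U.
Proof. by move=> sG [V AV <-] VU; rewrite (set_orbit_eq sG VU). Qed.

Lemma orbits_sub A G u U :
  invariant_family G A -> orbits A G u -> u U -> A U.
Proof. by move=> iA [V AV <-] [g Gg <-]; apply: iA. Qed.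

Lemma homeo_subgroup_inj G g : homeo_subgroup G -> G g -> injective g.
Proof. by case=> _ _ _ GV /GV [h _ [gh _]]; apply: can_inj gh. Qed.

Lemma invariant_atoms A G :
  homeo_subgroup G -> invariant_family G A -> invariant_family G (atoms A).
Proof.
move=> sG iA g a Gg [Aa [x ax] amin]; split; first exact: iA.
  by exists (g x), x.
move=> b Ab bga; have [_ _ _ GV] := sG; have [h Gh [gh hg]] := GV _ Gg.
have hga : h @` (g @` a) = a.
  by rewrite image_comp (_ : h \o g = idfun) ?image_id //; apply/funext => y /=.
have ghb : g @` (h @` b) = b.
  by rewrite image_comp (_ : g \o h = idfun) ?image_id //; apply/funext => y /=.
case: (amin (h @` b)); first exact: iA.
- by rewrite -[X in _ `<=` X]hga; apply: image_subset.
- by move=> hb0; left; rewrite -ghb hb0 image_set0.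
- by move=> hba; right; rewrite -ghb hba.
Qed.

Lemma subalgebraI A U V :
  clopen_subalgebra A -> A U -> A V -> A (U `&` V).
Proof.
by move=> [_ _ hC hU] HU HV; rewrite -[U `&` V]setCK setCI; apply: (hC); apply: hU; apply: hC.
Qed.

Lemma atomsP A a U : clopen_subalgebra A -> atoms A a -> A U ->
  a `&` U !=set0 -> a `<=` U.
Proof.
move=> sA [Aa _ amin] AU [x aUx].
case: (amin (a `&` U)); first exact: subalgebraI.
- exact: subIsetl.
- by move=> aU0; move: aUx; rewrite aU0.
- by move=> <-; apply: subIsetr.
Qed.

Lemma atoms_disj A a b : clopen_subalgebra A -> atoms A a -> atoms A b ->
  a `&` b !=set0 -> a = b.
Proof.
move=> sA aa ab ab0; apply/seteqP; split.
  by apply: (atomsP sA aa) => //; case: ab.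
by apply: (atomsP sA ab); rewrite 1?setIC //; case: aa.
Qed.

(* Every nonempty element of a finite subalgebra contains an atom. *)
Lemma atom_exists A U : clopen_subalgebra A -> finite_set A ->
  A U -> U !=set0 -> exists2 a, atoms A a & a `<=` U.
Proof.
move=> sA fA; have fin V : finite_set [set W | A W /\ W `<=` V].
  by apply: sub_finite_set fA => W [].
pose F V := fset_set [set W | A W /\ W `<=` V].
have [n] := ubnP #|` F U|%fset.
elim: n => // n IHn in U * => leUn AU U0.
have [aU|naU] := pselect (atoms A U); first by exists U.
have [b [Ab bU b0 bneU]] : exists b, [/\ A b, b `<=` U, b !=set0 & b <> U].
  apply: contrapT => nb; apply: naU; split=> // b Ab bU.
  have [->|/set0P b0] := eqVneq b set0; [by left | right].
  by apply: contrapT => bneU; apply: nb; exists b.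
have [] := IHn b _ Ab b0; last by move=> a aa ab; exists a => //; apply: subset_trans bU.
rewrite ltnS in leUn; apply: leq_trans leUn; apply: fproper_ltn_card.
rewrite fproperE; apply/andP; split.
  apply/fsubsetP => W; rewrite /F !in_fset_set // !inE => -[AW Wb].
  by split=> //; apply: subset_trans bU.
apply/fsubsetP => /(_ U); rewrite /F !in_fset_set // !inE.
by case=> [|_ Ub]; [split | apply: bneU; apply/seteqP].
Qed.

End OrbitTheory.

Section DimensionMorphism.
Context {X : topologicalType}.
Implicit Types (G : set (X -> X)) (A : set (set X)) (u w : set (set X)).

Lemma dim_class_rel A G : orbit_additive A G (dim_class A G).
Proof.
move=> u v w U V /mem_set uo /mem_set vo /mem_set wo uU vV UV wUV.
rewrite /dim_class !insubT /=.
rewrite -[X in _ = X](raddfD (\pi_(dim_group A G))); apply/eqP.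
rewrite -Quotient.idealrBE; apply/asboolP => S SZ; apply.
exists (Sub u uo), (Sub v vo), (Sub w wo), U, V; split=> //.
by rewrite opprD addrA addrAC.
Qed.

Lemma dim_classD A G U V : homeo_subgroup G -> A U -> A V -> A (U `|` V) ->
  U `&` V = set0 ->
  dim_class A G (set_orbit G (U `|` V)) =
  dim_class A G (set_orbit G U) + dim_class A G (set_orbit G V).
Proof.
move=> sG AU AV AUV UV; apply: (@dim_class_rel A G _ _ _ U V) => //;
  by [exists U | exists V | exists (U `|` V) | apply: set_orbit_refl].
Qed.

(* The map induced by inclusions A `<=` A' and G `<=` G': it sends the class of
   the G-orbit of U to the class of the G'-orbit of U. In a direct system these
   are all the connecting morphisms (dim_morphism_comp), not only those between
   consecutive levels. *)
Definition dim_morphism A G A' G' : dim_range A G -> dim_range A' G' :=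
  dim_lift (fun u => dim_class A' G' (\bigcup_(U in u) set_orbit G' U)).

Section Inclusion.
Variables (A A' : set (set X)) (G G' : set (X -> X)).
Hypotheses (sG : homeo_subgroup G) (sG' : homeo_subgroup G').
Hypotheses (iA : invariant_family G A).
Hypotheses (AA' : A `<=` A') (GG' : G `<=` G').

Let satE u U : orbits A G u -> u U ->
  \bigcup_(V in u) set_orbit G' V = set_orbit G' U.
Proof.
move=> uAG uU; rewrite (orbitsE sG uAG uU); apply/seteqP; split=> W.
  by move=> [V [g Gg gUV]]; rewrite (@set_orbit_eq _ _ U) //; exists g => //; apply: GG'.
by exists U => //; apply: set_orbit_refl.
Qed.

Let sat_add : orbit_additive A G
  (fun u => dim_class A' G' (\bigcup_(U in u) set_orbit G' U)).
Proof.
move=> u v w U V uo vo wo uU vV UV wUV.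
rewrite (satE uo uU) (satE vo vV) (satE wo wUV) dim_classD //; apply: AA'.
- exact: (orbits_sub iA uo uU).
- exact: (orbits_sub iA vo vV).
- exact: (orbits_sub iA wo wUV).
Qed.

Lemma dim_morphism_class U : A U ->
  dim_morphism A' G' (dim_class A G (set_orbit G U)) =
  dim_class A' G' (set_orbit G' U).
Proof.
move=> AU; have oU : orbits A G (set_orbit G U) by exists U.
by rewrite [LHS]dim_lift_class // (satE oU (set_orbit_refl U sG)).
Qed.

Lemma dim_morphismP :
  scaled_group_morphism (dim_morphism (A := A) (G := G) A' G').
Proof.
have fD : {morph dim_morphism (A := A) (G := G) A' G' : x y / x + y}.
  exact: dim_liftD.
have oA' U : A U -> orbits A' G' (set_orbit G' U) by exists U => //; exact: AA'.
split; first exact: fD.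
- move=> x; case=> s sP ->.
  have f0 : dim_morphism A' G' (0 : dim_range A G) = 0.
    by apply: (addIr (dim_morphism A' G' (0 : dim_range A G))); rewrite -fD !add0r.
  exists [seq \bigcup_(U in u) set_orbit G' U | u <- s].
    move=> _ /mapP[u us ->]; have [U AU uE] := sP _ us.
    have uU : u U by rewrite -uE; apply: set_orbit_refl.
    by rewrite (satE (sP _ us) uU); apply: oA'.
  rewrite (big_morph _ fD f0) big_map big_seq [RHS]big_seq.
  by apply: eq_bigr => u us; apply: dim_lift_class => //; apply: sP.
- move=> x; case=> u [U AU <-] <-; rewrite dim_morphism_class //.
  by exists (set_orbit G' U) => //; exact: oA'.
Qed.
End Inclusion.

Lemma dim_range_ext A G (W : zmodType) (f g : dim_range A G -> W) :
  {morph f : x y / x + y} -> {morph g : x y / x + y} ->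
  (forall U, A U -> f (dim_class A G (set_orbit G U)) =
                    g (dim_class A G (set_orbit G U))) -> f =1 g.
Proof.
move=> fD gD fg.
have h0 (h : dim_range A G -> W) : {morph h : x y / x + y} -> h 0 = 0.
  by move=> hD; apply: (addIr (h 0)); rewrite -hD !add0r.
have hM (h : dim_range A G -> W) : {morph h : x y / x + y} ->
    forall x (k : int), h (x *~ k) = h x *~ k.
  move=> hD x; have hMn y n : h (y *+ n) = h y *+ n.
    by elim: n => [|n IHn]; rewrite ?mulr0n ?h0 // !mulrS hD IHn.
  have hN y : h (- y) = - h y.
    by apply: (addIr (h y)); rewrite -hD !addNr h0.
  by case=> n; rewrite ?NegzE ?mulrNz ?hN -?pmulrn hMn.
elim/quotW; elim/freeg_ind_dom0 => [|k u D _ _ IHD].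
  by rewrite raddf0 (h0 f) ?(h0 g).
rewrite raddfD fD gD IHD; congr (_ + _).
rewrite -[k]intz -freegU_mulz raddfMz (hM f) // (hM g) //; congr (_ *~ _).
have [U AU Uu] : orbits A G (val u) := set_mem (valP u).
have := fg U AU; rewrite Uu /dim_class insubT; first exact: valP.
by move=> uA; rewrite (_ : Sub _ _ = u) //; apply: val_inj.
Qed.

Lemma dim_morphism_comp A G A' G' A'' G'' :
  homeo_subgroup G -> homeo_subgroup G' -> homeo_subgroup G'' ->
  invariant_family G A -> invariant_family G' A' ->
  A `<=` A' -> A' `<=` A'' -> G `<=` G' -> G' `<=` G'' ->
  forall x : dim_range A G,
    dim_morphism A'' G'' (dim_morphism A' G' x) = dim_morphism A'' G'' x.
Proof.
move=> sG sG' sG'' iA iA' AA' AA'' GG' GG''.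
have AA3 := subset_trans AA' AA''; have GG3 := subset_trans GG' GG''.
have [D1 _ _] := dim_morphismP sG sG' iA AA' GG'.
have [D2 _ _] := dim_morphismP sG' sG'' iA' AA'' GG''.
have [D3 _ _] := dim_morphismP sG sG'' iA AA3 GG3.
apply: dim_range_ext => [x y|//|U AU]; first by rewrite D1 D2.
by rewrite !dim_morphism_class //; apply: AA'.
Qed.

End DimensionMorphism.

Section DimensionMatrix.
Context {X : topologicalType}.
Implicit Types (G : set (X -> X)) (A : set (set X)).

(* M is the matrix of phi in the bases of classes of atom orbits. *)
Definition describes A G A' G' (phi : dim_range A G -> dim_range A' G')
    (M : atom_orbits A G -> atom_orbits A' G' -> int) :=
  forall v : atom_orbits A G,
    phi (dim_class A G (val v)) =
    \sum_(w \in [set: atom_orbits A' G']) dim_class A' G' (val w) *~ M v w.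

Definition members_within (w : set (set X)) (U : set X) : nat :=
  #|` fset_set (w `&` [set b | b `<=` U])%classic |%fset.

(* The number of atoms in w contained in a given atom in v. *)
Definition bratteli_matrix A G A' G'
    (v : atom_orbits A G) (w : atom_orbits A' G') : int :=
  (members_within (val w) (xget set0 (val v)))%:Z.

(* This property is not stable under products: two consecutive connecting
   morphisms may have 0/1 matrices while their composite does not. *)
Definition zero_one_matrix (I J : Type) (M : I -> J -> int) :=
  forall i j, M i j = 0 \/ M i j = 1.

Section Counting.
Variables (A : set (set X)) (G : set (X -> X)).
Hypotheses (sG : homeo_subgroup G) (sA : clopen_subalgebra A).
Hypotheses (fA : finite_set A) (iA : invariant_family G A).
Implicit Types w : set (set X).

Let atom_orbit w b : atom_orbits A G w -> w b -> atoms A b.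
Proof. exact: (orbits_sub (invariant_atoms sG iA)). Qed.

Let fin w U : atom_orbits A G w -> finite_set (w `&` [set b | b `<=` U]).
Proof.
move=> wV; apply: sub_finite_set fA => b [wb _].
by have [] := atom_orbit wV wb.
Qed.

Let countU w U V : atom_orbits A G w -> A U -> A V -> U `&` V = set0 ->
  members_within w (U `|` V) = (members_within w U + members_within w V)%N.
Proof.
move=> wV AU AV UV; rewrite /members_within.
rewrite (_ : _ `&` _ = (w `&` [set b | b `<=` U]) `|` (w `&` [set b | b `<=` V])).
  rewrite fset_setU; [|exact: fin|exact: fin].
  rewrite cardfsU -fset_setI; [|exact: fin|exact: fin].
  rewrite (_ : (w `&` _) `&` _ = set0) ?fset_set0 ?cardfs0 ?subn0 //.
  rewrite -subset0 => b [[wb bU] [_ bV]].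
  have [_ [x bx] _] := atom_orbit wV wb.
  have : (U `&` V) x by split; [exact: bU | exact: bV].
  by rewrite UV.
apply/seteqP; split=> b; last first.
  by case=> -[wb bU]; split=> // x /bU; [left | right].
move=> [wb bUV]; have ab := atom_orbit wV wb; have [_ [x bx] _] := ab.
by have [Ux|Vx] := bUV x bx; [left | right]; split=> //;
  apply: (atomsP sA ab) => //; exists x.
Qed.

Let countJ w U g : atom_orbits A G w -> A U -> G g ->
  members_within w (g @` U) = members_within w U.
Proof.
move=> wV AU Gg; rewrite /members_within.
have [_ _ _ GV] := sG; have [h Gh [gh hg]] := GV _ Gg.
have gK (V : set X) : h @` (g @` V) = V.
  by rewrite image_comp (_ : h \o g = idfun) ?image_id //; apply/funext => y /=.
have hK (V : set X) : g @` (h @` V) = V.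
  by rewrite image_comp (_ : g \o h = idfun) ?image_id //; apply/funext => y /=.
have wJ k b : G k -> w b -> w (k @` b).
  by move=> Gk wb; rewrite (orbitsE sG wV wb); exists k.
rewrite (_ : _ `&` _ = (fun b => g @` b) @` (w `&` [set b | b `<=` U])).
  rewrite fset_set_image; last exact: fin.
  rewrite card_imfset // => V W /= gVW.
  by rewrite -[V]gK gVW gK.
apply/seteqP; split=> b.
  move=> [wb bgU]; exists (h @` b) => //; split; first exact: wJ.
  by rewrite -[U]gK; apply: image_subset.
by move=> [c [wc cU] <-]; split; [exact: wJ | exact: image_subset].
Qed.

Let count_atom w a : atom_orbits A G w -> atoms A a ->
  members_within w a = `[< w a >].
Proof.
move=> wV aa; rewrite /members_within.
have sub b : w b -> b `<=` a -> b = a.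
  move=> wb ba; have ab := atom_orbit wV wb; have [_ [x bx] _] := ab.
  by apply: (atoms_disj sA) => //; exists x; split=> //; apply: ba.
case: asboolP => [wa|nwa].
  rewrite (_ : _ `&` _ = [set a]) ?fset_set1 ?cardfs1 //.
  apply/seteqP; split=> b; first by case=> /sub.
  by move=> ->; split.
rewrite (_ : _ `&` _ = set0) ?fset_set0 ?cardfs0 //.
by rewrite -subset0 => b [wb /(sub _ wb) ba]; rewrite ba in wb.
Qed.

(* A finitely additive function on A is determined by its values on atoms. *)
Let additive_ext (W : zmodType) (f g : set X -> W) :
  (forall U V, A U -> A V -> U `&` V = set0 -> f (U `|` V) = f U + f V) ->
  (forall U V, A U -> A V -> U `&` V = set0 -> g (U `|` V) = g U + g V) ->
  (forall a, atoms A a -> f a = g a) -> forall U, A U -> f U = g U.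
Proof.
move=> fD gD fg; have [_ A0 hC _] := sA.
have f0 (h : set X -> W) :
    (forall U V, A U -> A V -> U `&` V = set0 -> h (U `|` V) = h U + h V) ->
    h set0 = 0.
  by move=> /(_ set0 set0 A0 A0 (setI0 _)); rewrite setU0 => /eqP;
    rewrite -[X in X == _]addr0 (inj_eq (addrI _)) => /eqP.
have finA V : finite_set [set W | A W /\ W `<=` V].
  by apply: sub_finite_set fA => ? [].
pose F V := fset_set [set W | A W /\ W `<=` V].
move=> U; have [n] := ubnP #|` F U|%fset.
elim: n => // n IHn in U * => leUn AU.
have [->|/set0P U0] := eqVneq U set0; first by rewrite !f0.
have [a aa aU] := atom_exists sA fA AU U0.
have [Aa [x ax] _] := aa.
have AUa : A (U `\` a) by rewrite setDE; apply: subalgebraI => //; apply: hC.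
have disj : a `&` (U `\` a) = set0 by rewrite setDIK.
have -> : U = a `|` (U `\` a) by rewrite setDUK.
rewrite fD // gD // fg // IHn //.
rewrite ltnS in leUn; apply: leq_trans leUn; apply: fproper_ltn_card.
rewrite fproperE; apply/andP; split.
  apply/fsubsetP => V; rewrite /F !in_fset_set // !inE => -[AV VU].
  by split=> //; apply: subset_trans VU _; apply: subDsetl.
apply/fsubsetP => /(_ U); rewrite /F !in_fset_set // !inE.
by case=> [|_ UUa]; [split | case: (UUa x (aU x ax)) => _ /(_ ax)].
Qed.

Let finV : finite_set [set: atom_orbits A G].
Proof.
have fV : finite_set (atom_orbits A G).
  by apply: finite_image; apply: sub_finite_set fA => a [].
rewrite (_ : setT = (val : atom_orbits A G -> _) @^-1` atom_orbits A G).
  by apply: finite_preimage => // x y _ _ /val_inj.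
by apply/seteqP; split=> // w _; exact: (set_mem (valP w)).
Qed.

Let count_repr w u V : atom_orbits A G w -> orbits A G u -> u V ->
  members_within w (xget set0 u) = members_within w V.
Proof.
move=> wV uo uV; have : u (xget set0 u) by exact: (xgetPex set0 (ex_intro _ _ uV)).
rewrite {1}(orbitsE sG uo uV) => -[g Gg <-]; apply: countJ => //.
exact: (orbits_sub iA uo uV).
Qed.

(* The coordinate of x at the atom orbit w. *)
Definition dim_coord w : dim_range A G -> int :=
  dim_lift (fun u => (members_within w (xget set0 u))%:Z).

Let coord_additive w : atom_orbits A G w ->
  orbit_additive A G (fun u => (members_within w (xget set0 u))%:Z).
Proof.
move=> wV u v t U V uo vo to uU vV UV tUV.
rewrite (count_repr wV uo uU) (count_repr wV vo vV) (count_repr wV to tUV).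
rewrite countU ?PoszD //; first exact: (orbits_sub iA uo uU).
exact: (orbits_sub iA vo vV).
Qed.

Lemma dim_coordD w : atom_orbits A G w ->
  {morph dim_coord w : x y / x + y}.
Proof. by move=> wV; apply: dim_liftD; apply: coord_additive. Qed.

Lemma dim_coord_class w U : atom_orbits A G w -> A U ->
  dim_coord w (dim_class A G (set_orbit G U)) = (members_within w U)%:Z.
Proof.
move=> wV AU; have oU : orbits A G (set_orbit G U) by exists U.
rewrite /dim_coord dim_lift_class //; last exact: coord_additive.
by rewrite (count_repr wV oU (set_orbit_refl U sG)).
Qed.

Lemma dim_coord_atom w w' : atom_orbits A G w -> atom_orbits A G w' ->
  dim_coord w (dim_class A G w') = (w == w').
Proof.
move=> wV [a aa <-]; rewrite dim_coord_class //; last by case: aa.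
rewrite count_atom //; congr (Posz (nat_of_bool _)).
apply/asboolP/eqP => [wa|->]; first exact: (orbitsE sG wV wa).
exact: set_orbit_refl.
Qed.

Lemma dim_class_atoms U : A U ->
  dim_class A G (set_orbit G U) =
  \sum_(w \in [set: atom_orbits A G])
     dim_class A G (val w) *~ (members_within (val w) U)%:Z.
Proof.
have vV (w : atom_orbits A G) : atom_orbits A G (val w).
  exact: (set_mem (valP w)).
move: U; apply: (@additive_ext _ (fun U => dim_class A G (set_orbit G U))
  (fun U => \sum_(w \in [set: atom_orbits A G])
     dim_class A G (val w) *~ (members_within (val w) U)%:Z))
  => [V W AV AW VW|V W AV AW VW|a aa].
- by apply: dim_classD => //; case: sA => _ _ _; apply.
- rewrite -fsbig_split //; apply: eq_fsbigr => w _.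
  by rewrite countU // PoszD mulrzDr.
have ao : atom_orbits A G (set_orbit G a) by exists a.
pose w0 : atom_orbits A G := exist _ (set_orbit G a) (mem_set ao).
rewrite (fsbigD1 w0) //= fsbig1 ?addr0.
  by rewrite count_atom // asboolT //; apply: set_orbit_refl.
move=> w [_ ww0]; rewrite (count_atom (vV w) aa) asboolF // => wa.
by apply: ww0; apply: val_inj; rewrite /= (orbitsE sG (vV w) wa).
Qed.

Lemma dim_coord_sum (M : atom_orbits A G -> int) (w : atom_orbits A G) :
  dim_coord (val w)
    (\sum_(w' \in [set: atom_orbits A G]) dim_class A G (val w') *~ M w') = M w.
Proof.
have vV (w' : atom_orbits A G) : atom_orbits A G (val w').
  exact: (set_mem (valP w')).
have cD := dim_coordD (vV w).
have c0 : dim_coord (val w) 0 = 0.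
  by apply: (addIr (dim_coord (val w) 0)); rewrite -cD !add0r.
have cN x : dim_coord (val w) (- x) = - dim_coord (val w) x.
  by apply: (addIr (dim_coord (val w) x)); rewrite -cD !addNr c0.
have cMn x n : dim_coord (val w) (x *+ n) = dim_coord (val w) x *+ n.
  by elim: n => [|n IHn]; rewrite ?mulr0n // !mulrS cD IHn.
have cM x (k : int) : dim_coord (val w) (x *~ k) = dim_coord (val w) x *~ k.
  by case: k => n; rewrite ?NegzE ?mulrNz ?cN -?pmulrn cMn.
rewrite fsbig_finite //= (big_morph _ cD c0) (bigD1_seq w) ?fset_uniq //=;
  last by rewrite in_fset_set // inE.
rewrite cM (dim_coord_atom (vV w) (vV w)) eqxx intz big1 ?addr0 // => w' w'w.
by rewrite cM (dim_coord_atom (vV w) (vV w')) (inj_eq val_inj) eq_sym (negPf w'w) mul0rz.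
Qed.

End Counting.

Section MatrixOfInclusion.
Variables (A A' : set (set X)) (G G' : set (X -> X)).
Hypotheses (sG : homeo_subgroup G) (sG' : homeo_subgroup G').
Hypotheses (iA : invariant_family G A) (iA' : invariant_family G' A').
Hypotheses (AA' : A `<=` A') (GG' : G `<=` G').
Hypotheses (sA' : clopen_subalgebra A') (fA' : finite_set A').

Let phi_atom (v : atom_orbits A G) :
  dim_morphism A' G' (dim_class A G (val v)) =
  \sum_(w \in [set: atom_orbits A' G'])
     dim_class A' G' (val w) *~ bratteli_matrix v w.
Proof.
have vo : atom_orbits A G (val v) := set_mem (valP v).
have va : (val v : set (set X)) (xget set0 (val v)).
  have [a _ av] := vo; apply: (xgetPex set0); exists a.
  by rewrite -av; apply: set_orbit_refl.
have [Aa _ _] := orbits_sub (invariant_atoms sG iA) vo va.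
rewrite [in LHS](orbitsE sG vo va) dim_morphism_class //.
by rewrite (dim_class_atoms sG' sA' fA' iA') //; apply: AA'.
Qed.

Lemma describesP (M : atom_orbits A G -> atom_orbits A' G' -> int) :
  describes (dim_morphism A' G') M <-> M = @bratteli_matrix A G A' G'.
Proof.
split=> [MP|-> v]; last exact: phi_atom.
apply/funext => v; apply/funext => w.
have := MP v; rewrite phi_atom => /(congr1 (dim_coord (val w))).
by rewrite !(dim_coord_sum sG' sA' fA' iA').
Qed.

(* The count does not depend on the atom chosen in v. *)
Lemma bratteli_matrixE (v : atom_orbits A G) (w : atom_orbits A' G') a :
  (val v : set (set X)) a -> bratteli_matrix v w = (members_within (val w) a)%:Z.
Proof.
move=> va; have vo : atom_orbits A G (val v) := set_mem (valP v).
have wo : atom_orbits A' G' (val w) := set_mem (valP w).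
have [Aa _ _] := orbits_sub (invariant_atoms sG iA) vo va.
pose b := xget set0 (val v).
have vb : (val v : set (set X)) b by exact: (xgetPex set0 (ex_intro _ _ va)).
have [Ab _ _] := orbits_sub (invariant_atoms sG iA) vo vb.
rewrite /bratteli_matrix -/b.
rewrite -(dim_coord_class sG' sA' fA' iA' wo (AA' Aa)).
rewrite -(dim_coord_class sG' sA' fA' iA' wo (AA' Ab)).
congr (dim_coord _ (dim_class _ _ _)).
move: vb; rewrite (orbitsE sG vo va) => -[g Gg <-].
by apply: set_orbit_eq => //; exists g => //; apply: GG'.
Qed.

End MatrixOfInclusion.
End DimensionMatrix.

(* Main.v *)
Require Import Defs.
From mathcomp Require Import all_boot all_order all_algebra.
From mathcomp Require Import finmap.
From mathcomp Require Import all_classical all_reals all_analysis.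

(** The entries of all the matrices from level n to levels m >= n are 0 or 1
    exactly when no atom of B_n contains two distinct atoms of some B_m in one
    G_m-orbit.  If this holds, the atoms of B_n witness uniform discreteness:
    two distinct points of one G-orbit in an atom of B_n would be separated by
    some B_m, with m large enough for G_m to move one to the other, and the
    atoms of B_m around them would lie in one orbit.  Conversely, by compactness
    a witnessing clopen partition P is refined by the atoms of B_n for all large
    n, and if b and g b lie in one atom of B_n, then any x in b shares a block
    of P with g x, so g x = x and the atoms b and g b meet. *)

Set Implicit Arguments.
Unset Strict Implicit.
Unset Printing Implicit Defensive.

Local Open Scope classical_set_scope.

Lemma card_fset_set_le1P (T : choiceType) (S : set T) :
  finite_set S -> (#|` fset_set S|%fset <= 1)%N <-> is_subset1 S.
Proof.
move=> fS; split=> [S1 x y Sx Sy|S1].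
  have : ([fset x; y] `<=` fset_set S)%fset.
    by apply/fsubsetP => z; rewrite !inE => /orP[] /eqP->; rewrite in_fset_set // inE.
  move=> /fsubset_leq_card/leq_trans/(_ S1); rewrite cardfs2.
  by case: eqVneq.
have [->|/set0P[x Sx]] := eqVneq S set0; first by rewrite fset_set0 cardfs0.
rewrite (_ : S = [set x]) ?fset_set1 ?cardfs1 //.
by apply/seteqP; split=> [y Sy|_ ->//]; apply: S1.
Qed.

Section Atoms.
Context {X : topologicalType}.
Implicit Types (G : set (X -> X)) (A : set (set X)).

(** The union of the finitely many atoms lies in [A], and so does its complement, which would
    contain a further atom if it were nonempty. *)
Lemma atoms_cover A x : clopen_subalgebra A -> finite_set A ->
  exists2 a, atoms A a & a x.
Proof.
move=> sA fA; have [_ A0 AC AU] := sA.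
have fat : finite_set (atoms A) by apply: sub_finite_set fA => a [].
pose V := \bigcup_(a in atoms A) a.
have AV : A V.
  rewrite /V -bigsetU_fset_set // big_seq; apply: big_ind => // a.
  by rewrite in_fset_set // inE => -[].
apply: contrapT => nx.
have Vx : (~` V) !=set0.
  by exists x => -[a aa ax]; apply: nx; exists a.
have [a aa aV] := atom_exists sA fA (AC _ AV) Vx.
by have [_ [y ay] _] := aa; apply: (aV y ay); exists a.
Qed.

Lemma atoms_partition A : clopen_subalgebra A -> finite_set A ->
  partition (atoms A) id [set: X].
Proof.
move=> sA fA; split=> [|a b aa ab|a []//].
  apply/seteqP; split=> // x _; have [a aa ax] := atoms_cover x sA fA.
  by exists a.
exact: (atoms_disj sA aa ab).
Qed.

(** An entry counts the members of one [G']-orbit that lie inside an atom [a]. Any two of them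
    differ by some [g] in [G'], so a count of at most 1 means that no [g] moves [b] to a different
    atom within [a]. *)
Lemma zero_one_bratteliP A A' G G' :
  homeo_subgroup G -> homeo_subgroup G' ->
  invariant_family G A -> invariant_family G' A' ->
  A `<=` A' -> G `<=` G' -> clopen_subalgebra A' -> finite_set A' ->
  zero_one_matrix (@bratteli_matrix _ A G A' G') <->
  forall a b g, atoms A a -> atoms A' b -> G' g ->
    b `<=` a -> g @` b `<=` a -> g @` b = b.
Proof.
move=> sG sG' iA iA' AA' GG' sA' fA'.
have fin (w : atom_orbits A' G') a :
    finite_set ((val w : set (set X)) `&` [set b | b `<=` a]).
  apply: sub_finite_set fA' => b [wb _].
  by have [] := orbits_sub (invariant_atoms sG' iA') (set_mem (valP w)) wb.
split=> [M01 a b g aa ab Gg ba gba|M01 v w].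
  pose v : atom_orbits A G :=
    exist _ (set_orbit G a) (mem_set (ex_intro2 _ _ a aa erefl)).
  pose w : atom_orbits A' G' :=
    exist _ (set_orbit G' b) (mem_set (ex_intro2 _ _ b ab erefl)).
  have va : (val v : set (set X)) a by apply: set_orbit_refl.
  have : (members_within (val w) a <= 1)%N.
    (* The entry is defined by a chosen atom of [v]; independence of that choice lets [a] take its
       place. *)
    have := M01 v w; rewrite (bratteli_matrixE sG sG' iA iA' AA' GG' sA' fA' w va).
    by case=> -[->].
  move=> /card_fset_set_le1P; apply; first exact: fin.
    by split=> //; exists g.
  by split=> //; apply: set_orbit_refl.
have vo : atom_orbits A G (val v) := set_mem (valP v).
have wo : atom_orbits A' G' (val w) := set_mem (valP w).
have [a aa av] := vo.
have va : (val v : set (set X)) a by rewrite -av; apply: set_orbit_refl.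
rewrite (bratteli_matrixE sG sG' iA iA' AA' GG' sA' fA' w va).
suff : (members_within (val w) a <= 1)%N.
  by case: (members_within _ _) => [|[|n]]; [left | right |].
apply/card_fset_set_le1P; first exact: fin.
move=> b c [wb ba] [wc ca].
have ab := orbits_sub (invariant_atoms sG' iA') wo wb.
move: wc ca; rewrite (orbitsE sG' wo wb) => -[g Gg <-] gba.
by rewrite (M01 a b g).
Qed.

End Atoms.

Section Decomposition.
Context {X : topologicalType}.
Variables (G : set (X -> X)) (Gn : nat -> set (X -> X)) (Bn : nat -> set (set X)).
Hypothesis dec : ample_decomposition G Gn Bn.

Lemma dec_group_mono n m : (n <= m)%N -> Gn n `<=` Gn m.
Proof.
apply: (homo_leq (r := fun S T => S `<=` T)) => [S|S T U|k].
- exact: subset_refl.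
- exact: subset_trans.
- exact: dec_group_incr dec k.
Qed.

Lemma dec_algebra_mono n m : (n <= m)%N -> Bn n `<=` Bn m.
Proof.
apply: (homo_leq (r := fun S T => S `<=` T)) => [S|S T U|k].
- exact: subset_refl.
- exact: subset_trans.
- exact: dec_algebra_incr dec k.
Qed.

(** Each member of [P] enters the algebras at its own level. Compactness, in near-covering form,
    makes the level uniform in the point, and an atom meeting a set of its algebra lies inside
    it. *)
Lemma clopen_cover_refined (P : set (set X)) :
  compact [set: X] -> P `<=` clopen -> cover P id = setT ->
  \forall n \near \oo, forall a, atoms (Bn n) a -> exists2 U, P U & a `<=` U.
Proof.
move=> /compact_near_coveringP cX Pclopen Pcover.
have : \forall n \near \oo, [set: X] `<=`
    [set x | exists U, [/\ P U, Bn n U & U x]].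
  apply: (cX nat \oo (fun n x => exists U, [/\ P U, Bn n U & U x])) => x _.
  have [U PU Ux] : cover P id x by rewrite Pcover.
  have [k _ BkU] : (\bigcup_n Bn n) U.
    by rewrite (dec_algebra_union dec); apply: Pclopen.
  have [Uopen _] := Pclopen _ PU.
  exists (U, [set n | (k <= n)%N]) => /=.
    by split; [exact: open_nbhs_nbhs | exact: nbhs_infty_ge].
  move=> [y n] [/= Uy kn]; exists U; split=> //.
  exact: dec_algebra_mono BkU.
apply: filterS => n sub a aa; have [_ [x ax] _] := aa.
have [U [PU BU Ux]] := sub x I; exists U => //.
by apply: (atomsP (dec_subalgebra dec n) aa BU); exists x.
Qed.

Lemma uniformly_discrete_atoms n : zero_dimensional X ->
  (forall m, (n <= m)%N -> forall a b g, atoms (Bn n) a -> atoms (Bn m) b ->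
     Gn m g -> b `<=` a -> g @` b `<=` a -> g @` b = b) ->
  uniformly_discrete G.
Proof.
move=> zX single; have sB := dec_subalgebra dec; have fB := dec_finite_algebra dec.
exists (atoms (Bn n)); split.
- by move=> a [Ba _ _]; have [+ _ _ _] := sB n; apply.
- exact: atoms_partition.
move=> x a aa y z [[g Gg <-] agx] [[h Gh <-] ahx].
apply: contrapT => /eqP gh.
have [U [Uclopen Ugx nUhx]] := zX _ _ gh.
have [i _ Gig] : (\bigcup_n Gn n) g by rewrite (dec_group_union dec).
have [j _ Gjh] : (\bigcup_n Gn n) h by rewrite (dec_group_union dec).
have [k _ BkU] : (\bigcup_n Bn n) U by rewrite (dec_algebra_union dec).
(* At this level [g], [h] and [U] are all available; [n] enters the maximum so that [single]
   applies. *)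
pose m := maxn n (maxn i (maxn j k)).
have nm : (n <= m)%N by rewrite leq_maxl.
have Gmg : Gn m g by apply: dec_group_mono Gig; rewrite !leq_max leqnn !orbT.
have Gmh : Gn m h by apply: dec_group_mono Gjh; rewrite !leq_max leqnn !orbT.
have BmU : Bn m U by apply: dec_algebra_mono BkU; rewrite !leq_max leqnn !orbT.
have [_ _ GM GV] := dec_subgroup dec m; have [g' Gg' [gK _]] := GV _ Gmg.
have [b ab bgx] := atoms_cover (g x) (sB m) (fB m).
have [iB _] := dec_full dec m.
(* Since [h \o g'] sends [g x] to [h x], it sends the atom [b] around [g x] to the atom around
   [h x]. *)
have Gf : Gn m (h \o g') by apply: GM.
have afb := invariant_atoms (dec_subgroup dec m) iB Gf ab.
have fbhx : ((h \o g') @` b) (h x) by exists (g x) => //=; rewrite gK.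
have Bma : Bn m a by apply: (dec_algebra_mono nm); case: aa.
have fb : (h \o g') @` b = b.
  apply: (single m nm a) => //.
    by apply: (atomsP (sB m) ab Bma); exists (g x).
  by apply: (atomsP (sB m) afb Bma); exists (h x).
(* The atom [b] meets [U] at [g x], hence lies in [U], yet it also contains [h x]. *)
apply: nUhx; apply: (atomsP (sB m) ab BmU); first by exists (g x).
by rewrite -fb.
Qed.

Lemma uniformly_discrete_single :
  compact [set: X] -> uniformly_discrete G ->
  \forall n \near \oo, forall m, (n <= m)%N ->
    forall a b g, atoms (Bn n) a -> atoms (Bn m) b ->
     Gn m g -> b `<=` a -> g @` b `<=` a -> g @` b = b.
Proof.
move=> cX [P [Pclopen [Pcover _ _] P1]].
apply: filterS (clopen_cover_refined cX Pclopen Pcover).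
move=> n refined m nm a b g aa ab Gg ba gba.
have [U PU aU] := refined a aa; have [_ [x bx] _] := ab.
have sub h : Gn m h -> G h by rewrite -(dec_group_union dec); exists m.
have [_ G1 _ _] := dec_subgroup dec m.
have gx : g x = x.
  (* Both [g x] and [x], the latter through [idfun], are points of the orbit of [x] in the block
     [U]. *)
  apply: (P1 x U PU); split.
  - by exists g => //; apply: sub.
  - by apply: aU; apply: gba; exists x.
  - by exists idfun => //; apply: sub.
  - by apply: aU; apply: ba.
have [iB _] := dec_full dec m.
apply: (atoms_disj (dec_subalgebra dec m)) => //.
  exact: invariant_atoms (dec_subgroup dec m) iB g b Gg ab.
by exists x; split=> //; exists x.
Qed.

End Decomposition.

Theorem corollary3p6
    (G : set (cantor_space -> cantor_space))
    (Gn : nat -> set (cantor_space -> cantor_space))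
    (Bn : nat -> set (set cantor_space))
    (M : forall n m : nat,
       atom_orbits (Bn n) (Gn n) -> atom_orbits (Bn m) (Gn m) -> int) :
  ample G ->
  ample_decomposition G Gn Bn ->
  (forall n m : nat, (n <= m)%N ->
     describes (@dim_morphism cantor_space (Bn n) (Gn n) (Bn m) (Gn m))
       (M n m)) ->
  uniformly_discrete G <->
  \forall n \near \oo, forall m : nat, (n <= m)%N -> zero_one_matrix (M n m).
Proof.
move=> _ dec MP.
have sG := dec_subgroup dec.
have iB n : invariant_family (Gn n) (Bn n) by have [] := dec_full dec n.
have sB := dec_subalgebra dec; have fB := dec_finite_algebra dec.
have M01P n m : (n <= m)%N -> zero_one_matrix (M n m) <->
    forall a b g, atoms (Bn n) a -> atoms (Bn m) b -> Gn m g ->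
      b `<=` a -> g @` b `<=` a -> g @` b = b.
  move=> nm; have BB := dec_algebra_mono dec nm; have GG := dec_group_mono dec nm.
  (* A connecting morphism has only one matrix, so [M n m] is the Bratteli matrix. *)
  rewrite (iffLR (describesP (sG n) (sG m) (iB n) (iB m) BB GG (sB m) (fB m) _)
    (MP n m nm)).
  exact: zero_one_bratteliP.
split=> [/(uniformly_discrete_single dec cantor_space_compact)|/filter_ex[n M01]].
  by apply: filterS => n single m nm; apply/M01P => //; apply: single.
(* A single level [n] from the eventual range suffices here. *)
apply: (uniformly_discrete_atoms (n := n) dec cantor_zero_dimensional) => m nm.
by apply/M01P => //; apply: M01.
Qed.
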